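(* Let $X$ be a locally compact Hausdorff space with countable base and let $G\colon X\times X\to[0,\infty]$ be a Borel measurable function with $G>0$ satisfying (1) and (2) of the context. Let $P$ be an $F_\sigma$-set in $X$ with $c^\ast(P)=0$. Let $P_0\subset P$ be countable and let $A_m$, $m\in\mathbb N$, be closed sets in $X$ such that $\bigcup_{m\in\mathbb N}A_m=P$ and, for every $m\in\mathbb N$, the intersection $P_0\cap A_m$ is dense in $A_m$. Then there is a measure $\mu\in\mathcal M(P_0)$ such that $G\mu=\infty$ on $P$.
   Context: Assumptions on $G$: (1) For every $x\in X$, $\lim_{y\to x}G(x,y)=G(x,x)=\infty$, and $G(x,\cdot)$ is bounded outside every neighborhood of $x$. (2) $G$ has the local triangle property: every point of $X$ admits an open neighborhood $U$ such that the restriction $G|_{U\times U}$ has the triangle property, that is, there is $C>0$ (depending on $U$) with $\min\{G(x,z),G(y,z)\}\le C\,G(x,y)$ for all $x,y,z\in U$. For a Borel set $B\subset X$, $\mathcal M(B)$ denotes the set of all finite positive Radon measures $\mu$ on $X$ with $\mu(X\setminus B)=0$, and $\|\mu\|$ denotes the total mass of $\mu$. For $\mu\in\mathcal M(X)$ and $x\in X$, $G\mu(x):=\int G(x,y)\,d\mu(y)$. For $A\subset X$, $c^\ast(A):=\inf\{\|\mu\|:\mu\in\mathcal M(X),\ G\mu\ge 1\text{ on }A\}$ (with $\inf\emptyset=\infty$). *)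

(* Defs.v *)
From HB Require Import structures.
From mathcomp Require Import all_boot all_order all_algebra.
From mathcomp Require Import all_classical all_reals all_analysis.
From mathcomp Require Export measurable_realfun borel_hierarchy.

Set Implicit Arguments.
Unset Strict Implicit.
Unset Printing Implicit Defensive.

Import Order.TTheory GRing.Theory Num.Theory.
Import numFieldNormedType.Exports.

Local Open Scope classical_set_scope.
Local Open Scope ring_scope.
Local Open Scope ereal_scope.

(* [X] with its Borel sigma-algebra. Measurable types are pointed in the
   library, so spaces are [ptopologicalType]s, i.e. nonempty; the chosen point
   plays no role. *)
Notation borelType X := (g_sigma_algebraType (@open X)).

Section kernel_conditions.
Context {R : realType} {X : ptopologicalType}.
Variable G : X -> X -> \bar R.

(* Borel measurability for the Borel sets of the product topology. *)
Definition borel_kernel :=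
  measurable_fun [set: borelType (X * X)%type]
    (fun z : borelType (X * X)%type => G z.1 z.2).

Definition singular_on_diagonal := forall x : X,
  [/\ G x y @[y --> x] --> G x x,
      G x x = +oo &
      forall V : set X, nbhs x V ->
        exists M : R, forall y, ~ V y -> G x y <= M%:E].

Definition triangle_property (U : set X) :=
  exists2 C : R, (0 < C)%R &
    forall x y z, U x -> U y -> U z ->
      Order.min (G x z) (G y z) <= C%:E * G x y.

Definition local_triangle_property := forall p : X,
  exists2 U : set X, open_nbhs p U & triangle_property U.

End kernel_conditions.

Section potentials.
Context {R : realType} {X : ptopologicalType}.
Implicit Type mu : {finite_measure set (borelType X) -> \bar R}.

(* Local finiteness, the other requirement on a Radon measure, is automatic
   for finite measures. *)
Definition radon mu := forall B : set (borelType X), measurable B ->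
  mu B = ereal_sup [set mu K | K in [set K : set X | compact K /\ K `<=` B]].

Definition radon_on (B : set X) :
    set {finite_measure set (borelType X) -> \bar R} :=
  [set mu | radon mu /\ mu (~` B) = 0].

Variable G : X -> X -> \bar R.

Definition potential mu (x : X) : \bar R := \int[mu]_(y in setT) G x y.

Definition cstar (A : set X) : \bar R :=
  ereal_inf [set mu setT | mu in
    [set mu | radon_on setT mu /\ forall x, A x -> 1 <= potential mu x]].

End potentials.

(* Main.v *)
Require Import Defs.
From HB Require Import structures.
From mathcomp Require Import all_boot all_order all_algebra.
From mathcomp Require Import all_classical all_reals all_analysis.
Import Order.TTheory GRing.Theory Num.Theory.
Import numFieldNormedType.Exports.
Local Open Scope classical_set_scope.
Local Open Scope ring_scope.
Local Open Scope ereal_scope.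

(** Since c*(P) = 0, there are measures mu_k of mass at most 2^-k whose
    potentials are at least 1 on P; their sum is a finite measure mu with
    potential +oo on P ([cstar0_polar]). The task is to replace mu by a measure
    living on P0.

    Where G has the triangle property, 1/G is a quasi-ultrametric: two points
    at which G(., z) is at least a satisfy G >= a/C between them. Take a compact
    K inside such an open set U, with K in the closure of P0. Off U the kernel
    G(x, .) is bounded, so the part of mu in U already has potential +oo at
    every x of K ([infinite_potential_local]). Hence, for every k in K, the
    kernel truncated at some level n has a large integral against mu over U,
    and P0 has a point p with G(k, p) >= n. The sets where G(k, .) >= n are
    neighbourhoods of k, and finitely many of them cover K. Send every z to the
    point p of the resulting finite set for which G(p, z) is largest. For x in
    the neighbourhood of k, the truncated value min(G(k, z), n) is then at most
    C^3 G(x, T z), where T z is the image of z: all the points k, x, p, z and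
    T z are linked by values of G at least as large, up to powers of C
    ([triangle_relay]). So the image of mu under T is carried by P0, is no
    heavier than mu, and has potential at least 1 on K ([sweep_into]).

    As mu may be scaled to have arbitrarily small mass while its potential
    stays +oo on P, the images can be summed again to make the potential +oo
    on K ([capacity_null_polar]). Countably many such K cover P, because
    X has a countable base and P is an F_sigma, and infinite potentials survive
    countable superposition ([polar_bigcup]). Finally, a finite measure carried
    by a countable set is Radon, because its mass is exhausted by finite sets
    ([countable_support_radon]). *)

Set Implicit Arguments.
Unset Strict Implicit.
Unset Printing Implicit Defensive.

(** * Measure-theoretic preliminaries *)
Section measures.
Context d (T : measurableType d) (R : realType).

(** Monotone convergence along the truncations. Truncating is what makes the
    sweeping below work at points charged by the measure, where the kernel is
    infinite and no single point of the target set can do as well. *)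
Lemma truncated_integral_large (mu : {measure set T -> \bar R}) (D : set T)
    (f : T -> \bar R) (r : R) :
  measurable D -> measurable_fun D f -> (forall z, D z -> 0 <= f z) ->
  \int[mu]_(z in D) f z = +oo ->
  exists n : nat, r%:E <= \int[mu]_(z in D) Order.min (f z) n%:R%:E.
Proof.
move=> mD mf f0 foo.
have cvgf z : Order.min (f z) n%:R%:E @[n --> \oo] --> f z.
  have [->|fz] := eqVneq (f z) +oo.
    apply/cvgeyPge => A; near=> n.
    rewrite le_min leey/= lee_fin; near: n; exact: nbhs_infty_ger.
  have [M fM] : exists M : R, f z <= M%:E.
    case: (f z) fz => [s _|/eqP//|_]; [by exists s|exists 0%R].
    exact: leNye.
  apply: cvg_near_cst; near=> n; apply/min_idPl/(le_trans fM).
  rewrite lee_fin; near: n; exact: nbhs_infty_ger.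
have /cvgeyPge/(_ r) : \int[mu]_(z in D) Order.min (f z) n%:R%:E @[n --> \oo]
    --> +oo.
  rewrite -foo; under eq_integral do rewrite -(cvg_lim _ (cvgf _))//.
  apply: cvg_monotone_convergence => //.
  - by move=> n; apply: measurable_mine => //; exact: measurable_cst.
  - by move=> n z Dz; rewrite le_min f0//= lee_fin.
  - by move=> z Dz m n mn; rewrite le_min2// lee_fin ler_nat.
by move=> [n _ /(_ n (leqnn n))]; exists n.
Unshelve. all: by end_near. Qed.

Lemma geometric_mass_lty (nu : nat -> {measure set T -> \bar R}) :
  (forall k, nu k setT <= (1 / (2 ^ k.+1)%:R)%:E) -> mseries nu 0 setT < +oo.
Proof.
move=> nu_le; rewrite /mseries; apply: (@le_lt_trans _ _ 1); last exact: ltry.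
apply: (@le_trans _ _
    (\sum_(0 <= k <oo) (cst 0 k + (1 / (2 ^ k.+1)%:R)%:E : \bar R))).
  by apply: lee_nneseries => // k _; rewrite /cst add0e; exact: nu_le.
by apply: (le_trans (epsilon_trick xpredT _ _)) => //; rewrite eseries0// add0e.
Qed.

Lemma rescale_mass_le (nu : {measure set T -> \bar R}) (e : R) :
  nu setT < +oo -> (0 < e)%R ->
  exists2 c : {nonneg R}, (0 < c%:num)%R & mscale c nu setT <= e%:E.
Proof.
move=> nu_fin e0; have nu_num : nu setT \is a fin_num by rewrite ge0_fin_numE.
have m0 : (0 <= fine (nu setT))%R by rewrite fine_ge0.
have c0 : (0 < e / (1 + fine (nu setT)))%R by rewrite divr_gt0// ltr_wpDr.
exists (NngNum (ltW c0)) => //=.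
rewrite /mscale/= -[nu setT]fineK// -EFinM lee_fin.
rewrite -mulrA; apply: ler_piMr; first exact: ltW.
by rewrite mulrC ler_pdivrMr ?mul1r ?ltr_wpDr// lerDr.
Qed.

End measures.

(** * Borel sets, kernels and the Radon property *)

Section borel.
Context {R : realType} {X : ptopologicalType}.

Lemma borel_open (U : set (borelType X)) : @open X U -> measurable U.
Proof. exact: sub_sigma_algebra. Qed.

Lemma borel_closed (F : set (borelType X)) : @closed X F -> measurable F.
Proof.
move=> Fc; rewrite -[F]setCK; apply: measurableC; apply: borel_open.
exact: closed_openC.
Qed.

Lemma kernel_section_measurable (G : X -> X -> \bar R) (x : X) :
  borel_kernel G ->
  measurable_fun [set: borelType X] (G x : borelType X -> \bar R).
Proof.
move=> mG; pose pr (y : borelType X) : borelType (X * X)%type := (x, y).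
apply: (measurableT_comp (f := fun z : borelType (X * X)%type => G z.1 z.2) mG
  (g := pr)).
apply: (@measurability _ _ (borelType X) (borelType (X * X)%type) setT pr
  (@open (X * X)%type)); first by [].
move=> _ [V oV <-].
rewrite setTI; apply: borel_open.
apply: open_comp oV => y _; apply: cvg_pair; [exact: cvg_cst|exact: cvg_id].
Qed.

Hypothesis hX : hausdorff_space X.

Lemma borel_countable (S : set (borelType X)) : countable S -> measurable S.
Proof.
apply: countable_measurable => x; apply: borel_closed.
exact/accessible_closed_set1/hausdorff_accessible.
Qed.

(** The mass of B is exhausted by the finite, hence compact, subsets of its
    trace on S. *)
Lemma countable_support_radon (S : set (borelType X))
    (mu : {finite_measure set (borelType X) -> \bar R}) :
  countable S -> mu (~` S) = 0 -> radon mu.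
Proof.
move=> cS muS B mB; have mS := borel_countable cS.
have cBS : countable (B `&` S).
  by apply: sub_countable cS; apply: subset_card_le; exact: subIsetr.
have mBS : measurable (B `&` S) by exact: borel_countable.
have muBS : mu B = mu (B `&` S).
  rewrite (measureDI mu mB mS) [X in X + _](_ : _ = 0) ?add0e//.
  apply/eqP; rewrite -measure_le0 -muS; apply: le_measure; rewrite ?inE//.
  - exact: measurableD.
  - exact: measurableC.
apply/eqP; rewrite eq_le; apply/andP; split; last first.
  apply: ge_ereal_sup => _ [K [cK KB] <-]; apply: le_measure; rewrite ?inE//.
  by apply: borel_closed; exact: compact_closed.
rewrite muBS; have /pfcard_geP[BS0|[f]] := cBS.
  rewrite BS0; apply: ereal_sup_ubound; exists set0 => //.
  by split => //; exact: compact0.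
pose F n := [set f k | k in `I_n].
have fF n : finite_set (F n) by apply: finite_image.
have FBS n : F n `<=` B `&` S by move=> _ [k _ <-]; exact: funS.
have UF : \bigcup_n F n = B `&` S.
  apply/seteqP; split => [z [n _] /FBS//|z /(@surj _ _ _ _ f)[k _ <-]].
  by exists k.+1 => //; exists k => //=.
have cvgF : mu (F n) @[n --> \oo] --> mu (B `&` S).
  rewrite -UF; apply: nondecreasing_cvg_mu.
  - by move=> n; apply: borel_countable; exact: finite_set_countable.
  - by rewrite UF.
  - move=> m n mn; apply/subsetPset => _ [k /= km <-]; exists k => //=.
    exact: leq_trans mn.
rewrite -(cvg_lim _ cvgF)//; apply: lime_le.
  by apply/cvg_ex; exists (mu (B `&` S)).
apply: nearW => n; apply: ereal_sup_ubound; exists (F n) => //.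
by split; [exact: finite_compact|move=> z /FBS[]].
Qed.

End borel.

(** * Null capacity and infinite potentials *)

Section capacity.
Context {R : realType} {X : ptopologicalType}.
Variable G : X -> X -> \bar R.
Hypotheses (G_borel : borel_kernel G) (G_gt0 : forall x y, 0 < G x y).

Notation bmeasure := {measure set (borelType X) -> \bar R}.

Notation pot nu x := (\int[nu]_(y in [set: borelType X]) G x y).

Let G_ge0 x y : 0 <= G x y. Proof. exact: ltW. Qed.

Let mG x : measurable_fun [set: borelType X] (G x : borelType X -> \bar R).
Proof. exact: kernel_section_measurable. Qed.

(** Vanishing of the capacity c* when only measures carried by S compete. *)
Definition capacity_null (S Q : set X) := forall e : R, (0 < e)%R ->
  exists nu : bmeasure,
    [/\ nu setT <= e%:E, nu (~` S) = 0 & forall x, Q x -> 1 <= pot nu x].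

(** The finiteness of the mass is the point: a finite measure with infinite
    potential can be scaled down freely, which is the converse of
    [capacity_null_polar]. *)
Definition polar (S Q : set X) := exists nu : bmeasure,
  [/\ nu setT < +oo, nu (~` S) = 0 & forall x, Q x -> pot nu x = +oo].

Lemma polar_small (S Q : set X) (e : R) : polar S Q -> (0 < e)%R ->
  exists nu : bmeasure,
    [/\ nu setT <= e%:E, nu (~` S) = 0 & forall x, Q x -> pot nu x = +oo].
Proof.
move=> [nu [nu_fin nuS nuoo]] e0.
have [c c0 ce] := rescale_mass_le nu_fin e0.
exists (mscale c nu); split=> // [|x Qx]; first by rewrite /= /mscale nuS mule0.
by rewrite ge0_integral_mscale// nuoo// gt0_muley// lte_fin.
Qed.

(** Each of the summands, of mass at most 2^-(k+1), adds at least 1 to the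
    potential. *)
Lemma capacity_null_polar (S Q : set X) : capacity_null S Q -> polar S Q.
Proof.
move=> capQ; have e0 k : (0 < 1 / (2 ^ k.+1)%:R :> R)%R.
  by rewrite divr_gt0// ltr0n expn_gt0.
have /choice[nu nuP] k := capQ _ (e0 k).
exists (mseries nu 0); split=> [||x Qx].
- by apply: geometric_mass_lty => k; have [] := nuP k.
- by rewrite /= /mseries eseries0// => k _ _; have [] := nuP k.
rewrite ge0_integral_measure_series//; apply: eq_infty => r.
pose N := Num.bound `|r|%R.
apply: (@le_trans _ _ N%:R%:E); first 
  by rewrite lee_fin ltW// (le_lt_trans (ler_norm _))// archi_boundP.
apply: le_trans (nneseries_lim_ge N _); last first.
  by move=> k _ _; exact: integral_ge0.
rewrite -[leLHS](_ : \sum_(0 <= k < N) 1 = _); last first.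
  by rewrite sumEFin sumr_const_nat subn0.
by apply: lee_sum => k _; have [_ _ ->] := nuP k.
Qed.

Lemma polar_bigcup (S : set X) (Q : nat -> set X) :
  (forall n, polar S (Q n)) -> polar S (\bigcup_n Q n).
Proof.
move=> polQ; have e0 k : (0 < 1 / (2 ^ k.+1)%:R :> R)%R.
  by rewrite divr_gt0// ltr0n expn_gt0.
have /choice[nu nuP] k := polar_small (polQ k) (e0 k).
exists (mseries nu 0); split=> [||x [n _ Qx]].
- by apply: geometric_mass_lty => k; have [] := nuP k.
- by rewrite /= /mseries eseries0// => k _ _; have [] := nuP k.
rewrite ge0_integral_measure_series//; apply/eqP; rewrite -leye_eq.
have [_ _ nuoo] := nuP n; rewrite -(nuoo _ Qx).
rewrite (nneseriesD1 (n := n))//; last by move=> k _; exact: integral_ge0.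
by rewrite leeDl// nneseries_ge0// => k _ _; exact: integral_ge0.
Qed.

Lemma cstar0_polar (P : set X) : cstar G P = 0 -> polar setT P.
Proof.
move=> cP0; apply: capacity_null_polar => e e0.
have cPe : cstar G P < e%:E by rewrite cP0 lte_fin.
have [_ [mu [_ muP] <-] mu_e] := ereal_inf_lt cPe.
by exists mu; split; [exact: ltW|rewrite setCT measure0|exact: muP].
Qed.

End capacity.

(** * Sweeping a measure onto a set *)

Section sweeping.
Context {R : realType} {X : ptopologicalType}.
Variable G : X -> X -> \bar R.
Hypotheses (G_borel : borel_kernel G) (G_gt0 : forall x y, 0 < G x y).
Hypothesis G_sing : singular_on_diagonal G.

Notation bmeasure := {measure set (borelType X) -> \bar R}.
Notation pot nu x := (\int[nu]_(y in [set: borelType X]) G x y).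

Let G_ge0 x y : 0 <= G x y. Proof. exact: ltW. Qed.

Let mG x : measurable_fun [set: borelType X] (G x : borelType X -> \bar R).
Proof. exact: kernel_section_measurable. Qed.

(** The part of the measure outside U contributes a finite amount, as G(x, .)
    is bounded there and the measure is finite. This is what reduces a kernel
    with only the local triangle property to a single good set U. *)
Lemma infinite_potential_local (mu : bmeasure) (U : set X) (x : X) :
  mu setT < +oo -> open U -> U x -> pot mu x = +oo ->
  \int[mu]_(z in (U : set (borelType X))) G x z = +oo.
Proof.
move=> mu_fin oU Ux muoo; have mU := borel_open oU; have mCU := measurableC mU.
have [_ _ /(_ U)[|M GM]] := G_sing x; first exact: open_nbhs_nbhs.
have far : \int[mu]_(z in ~` (U : set (borelType X))) G x z < +oo.
  apply: (@le_lt_trans _ _ (`|M|%:E * mu (~` (U : set (borelType X))))).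
    rewrite -integral_cst//; apply: ge0_le_integral => //.
    - by apply: measurable_funS (mG x).
    - by move=> z Uz; apply: le_trans (GM _ Uz) _; rewrite lee_fin ler_norm.
  apply: lte_mul_pinfty => //.
  by apply: le_lt_trans mu_fin; apply: le_measure; rewrite ?inE.
apply/eqP; rewrite -leye_eq leNgt; apply/negP => near_lty.
move: muoo; rewrite -(setUCr (U : set (borelType X))) ge0_integral_setU//;
  first last.
- by apply/disj_setPCl.
- by rewrite setUCr.
by move=> /eqP; rewrite -leye_eq leNgt lte_add_pinfty.
Qed.

Section triangle.
Variables (U : set X) (C : R).
Hypothesis C_gt0 : (0 < C)%R.
Hypothesis triU : forall x y z, U x -> U y -> U z ->
  Order.min (G x z) (G y z) <= C%:E * G x y.

(** Quasi-symmetry is the triangle property with z = x, because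
    G(x, x) = +oo. *)
Lemma triangle_sym x y : U x -> U y -> G y x <= C%:E * G x y.
Proof.
by move=> Ux Uy; have := triU Ux Uy Ux; have [_ -> _] := G_sing x;
  rewrite minye.
Qed.

Lemma triangle_trans (b : R) (a : \bar R) x y z : (0 <= b)%R ->
  U x -> U y -> U z -> a <= b%:E * G x z -> a <= b%:E * G y z ->
  a <= (b * C)%:E * G x y.
Proof.
move=> b0 Ux Uy Uz axz ayz; rewrite EFinM -muleA.
have := triU Ux Uy Uz; case: (leP (G x z)) => _ triz.
  by apply: (le_trans axz); apply: lee_wpmul2l; rewrite ?lee_fin.
by apply: (le_trans ayz); apply: lee_wpmul2l; rewrite ?lee_fin.
Qed.

(** Think of 1/G as a distance. The points x, p and z are all within 1/a of x0,
    so z is close to both x and p; as q is at least as close to z as p is, q is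
    close to x. The first step costs C for symmetry and C for passing through
    x0, the second costs C for passing through z. *)
Lemma triangle_relay (a : \bar R) x0 x p q z :
  U x0 -> U x -> U p -> U q -> U z ->
  a <= G x0 x -> a <= G x0 p -> a <= G x0 z -> G p z <= G q z ->
  a <= (C * C * C)%:E * G x q.
Proof.
move=> Ux0 Ux Up Uq Uz ax ap az pqz.
have C0 : (0 <= C)%R by exact: ltW.
have flip y : U y -> a <= G x0 y -> a <= C%:E * G y x0.
  by move=> Uy ay; exact: le_trans ay (triangle_sym Uy Ux0).
have axz : a <= (C * C)%:E * G x z.
  by apply: (@triangle_trans _ _ _ _ x0) => //; exact: flip.
have apz : a <= (C * C)%:E * G p z.
  by apply: (@triangle_trans _ _ _ _ x0) => //; exact: flip.
have aqz : a <= (C * C)%:E * G q z.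
  by apply: (le_trans apz); apply: lee_wpmul2l => //; rewrite lee_fin mulr_ge0.
by apply: triangle_trans aqz => //; rewrite mulr_ge0.
Qed.

End triangle.

(** A measurable choice, among finitely many points, of a point nearest to z
    for the distance 1/G. Measurability of the maximum itself keeps the
    induction going. *)
Lemma measurable_maximizer (p : X) (s : seq X) :
  exists T : borelType X -> borelType X,
  [/\ measurable_fun setT T, measurable_fun setT (fun z => G (T z) z),
      forall z, T z \in p :: s
    & forall z q, q \in p :: s -> G q z <= G (T z) z].
Proof.
elim: s => [|r s [T [mT mGT Ts Tmax]]].
  exists (cst p); split=> //; first exact: mG.
  - by move=> z; rewrite mem_head.
  - by move=> z q; rewrite inE => /eqP ->.
pose b z := G (T z) z <= G r z.
have mb : measurable_fun setT (b : borelType X -> bool).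
  exact: measurable_fun_lee mGT (mG r).
exists (fun z => if b z then r else T z); split.
- by apply: measurable_fun_ifT => //; exact: measurable_cst.
- rewrite (_ : (fun z => _) = (fun z => if b z then G r z else G (T z) z)).
    by apply: measurable_fun_ifT => //; exact: mG.
  by apply/funext => z; case: (b z).
- move=> z; case: ifP => _; first by rewrite !inE eqxx orbT.
  by have := Ts z; rewrite !inE => /orP[->//|->]; rewrite !orbT.
- move=> z q qs; have {qs} : q = r \/ q \in p :: s.
    move: qs; rewrite !inE => /or3P[->|/eqP ->|->]; rewrite ?orbT;
      by [left|right].
  have [bz [->//|/Tmax qT]|/negbT] := ifP (b z).
    exact: le_trans (qT z) bz.
  by rewrite /b -ltNge => rT [->|/Tmax//]; exact: ltW.
Qed.

(** The pushforward of mu under a nearest-point map into a well-chosen finite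
    subset of S. *)
Lemma sweep_into (mu : bmeasure) (S U K : set X) :
  open U -> triangle_property G U -> compact K -> K `<=` U ->
  K `<=` closure S ->
  (forall x, K x -> \int[mu]_(z in (U : set (borelType X))) G x z = +oo) ->
  exists nu : bmeasure,
    [/\ nu setT <= mu setT, nu (~` S) = 0 & forall x, K x -> 1 <= pot nu x].
Proof.
move=> oU [C C0 triU] cK KU KS muoo; have mU := borel_open oU.
have [K0|/set0P[x0 Kx0]] := eqVneq K set0.
  by exists mzero; split=> [||x]; [exact: measure_ge0| |rewrite K0].
have C3_gt0 : (0 < C * C * C)%R by rewrite !mulr_gt0.
(* C^3 is the constant lost in [triangle_relay]. *)
pose good x (w : nat * X) := [/\ (C * C * C)%:E <=
    \int[mu]_(z in (U : set (borelType X))) Order.min (G x z) w.1%:R%:E,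
  S w.2, U w.2 & w.1%:R%:E <= G x w.2].
pose V x (n : nat) := [set y | U y /\ n%:R%:E <= G x y].
have nbhsV x n : U x -> nbhs x (V x n).
  move=> Ux; have [cvgG Gxx _] := G_sing x.
  apply: filterI; first exact: open_nbhs_nbhs.
  by move: cvgG; rewrite Gxx => /cvgeyPge/(_ n%:R).
have /choice[w wP] x : exists w, K x -> good x w.
  (* The pair chosen for x outside K is a default value. *)
  have [Kx|nKx] := pselect (K x); last by exists (0%N, x).
  have [n n_large] := truncated_integral_large (C * C * C) mU
    (measurable_funTS (mG x)) (fun z _ => G_ge0 x z) (muoo x Kx).
  have [p [Sp [Up Gxp]]] := KS x Kx _ (nbhsV x n (KU x Kx)).
  by exists (n, p).
have := cK; rewrite compact_cover => /(_ X K (fun x => (V x (w x).1)^°)) [].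
- by move=> x _; exact: open_interior.
- by move=> x Kx; exists x => //; exact/nbhsV/KU.
move=> D DK Kcov.
(* The point attached to x0 only keeps the list of targets nonempty. *)
have [T [mT mGT Ts Tmax]] :=
  measurable_maximizer (w x0).2 [seq (w x).2 | x <- finmap.enum_fset D].
have T_good z : S (T z) /\ U (T z).
  have := Ts z; rewrite inE => /orP[/eqP ->|/mapP[k kD ->]].
    by have [] := wP x0 Kx0.
  by have /DK := kD; rewrite inE => /wP[].
exists (pushforward mu T); split=> [||x Kx].
- by rewrite /= /pushforward preimage_setT.
- rewrite /= /pushforward (_ : _ @^-1` _ = set0) ?measure0//.
  by apply/seteqP; split=> // z; have [] := T_good z.
have [k kD [Uk_x nk_x]] : exists2 k, k \in finmap.enum_fset D & V k (w k).1 x.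
  by have [k kD /interior_subset Vkx] := Kcov x Kx; exists k.
have /set_mem Kk := DK k kD; have [int_k Sk Uk nk_p] := wP k Kk.
have mGT_x : measurable_fun setT (fun z => G x (T z)).
  exact: (measurableT_comp (mG x) mT).
rewrite ge0_integral_pushforward// preimage_setT.
apply: (@le_trans _ _
    (\int[mu]_(z in (U : set (borelType X))) G x (T z))); last first.
  exact: ge0_subset_integral.
rewrite -(@lee_pmul2l _ (C * C * C)%:E)// ?lte_fin// mule1.
apply: (le_trans int_k); rewrite -ge0_integralZl//; last 2 first.
- exact: measurable_funTS.
- by rewrite lee_fin ltW.
apply: ge0_le_integral => //.
- by move=> z _; rewrite le_min G_ge0/= lee_fin.
- apply: measurable_mine; last exact: measurable_cst.
  exact: measurable_funTS.
- by apply: measurable_funeM; exact: measurable_funTS.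
move=> z Uz; have [_ UTz] := T_good z.
apply: (@triangle_relay U C C0 triU _ k x (w k).2 (T z) z) => //.
- exact: KU.
- by rewrite ge_min nk_x orbT.
- by rewrite ge_min nk_p orbT.
- by rewrite ge_min lexx.
- by apply: Tmax; rewrite inE; apply/orP; right; apply/mapP; exists k.
Unshelve. exact: mT.
Qed.

End sweeping.

(** * Countable compact covers and conclusion *)

Section covering.
Context {X : ptopologicalType}.

Lemma compact_nbhs_inside (x : X) (U : set X) :
  locally_compact [set: X] -> hausdorff_space X -> nbhs x U ->
  exists K : set X, [/\ compact K, nbhs x K & K `<=` U].
Proof.
move=> lcX hX xU; have [V + [cV clV]] := lcX x I; rewrite withinET => xV.
have [W xW WU] := compact_regular hX cV xV xU.
exists (V `&` closure W); split.
- by apply: compact_closedI => //; exact: closed_closure.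
- apply: filterI => //; apply: filterS xW; exact: subset_closure.
- by move=> z [_ /WU].
Qed.

(** Lindelof-type covering: a basic open set that fits into some compact subset
    of a good set is replaced by one such compact set; these basic sets already
    cover X. *)
Lemma countable_compact_cover (good : set (set X)) :
  locally_compact [set: X] -> hausdorff_space X -> @second_countable X ->
  (forall x : X, exists2 U, nbhs x U & good U) ->
  exists K : nat -> set X,
    [/\ forall n, compact (K n), forall n, exists2 U, good U & K n `<=` U
      & \bigcup_n K n = setT].
Proof.
move=> lcX hX [B cB [oB Bx]] good_nbhs.
pose F b := [set K | [/\ compact K, b `<=` K & exists2 U, good U & K `<=` U]].
have /choice[K KP] b : exists K,
    [/\ compact K, exists2 U, good U & K `<=` U & F b !=set0 -> b `<=` K].
  have [[K [cK bK KU]]|nFb] := pselect (F b !=set0).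
    by exists K.
  (* A basic set that fits into no such compact set is given the empty set. *)
  have [U _ gU] := good_nbhs point.
  by exists set0; split; [exact: compact0|exists U|].
have cover_b : \bigcup_(b in B) K b = setT.
  apply/seteqP; split=> // x _; have [U xU gU] := good_nbhs x.
  have [L [cL xL LU]] := compact_nbhs_inside lcX hX xU.
  have [b [Bb bx] bL] := Bx x L xL.
  exists b => //; have [_ _] := KP b; apply => //.
  by exists L; split => //; exists U.
have /pfcard_geP[B0|[f]] := cB.
  by have := cover_b; rewrite B0 bigcup_set0 => /seteqP[_ /(_ point I)].
exists (K \o f); split=> [n|n|]; try by have [] := KP (f n).
apply/seteqP; split=> // x; rewrite -cover_b => -[b Bb bx].
have [n _ fn] := @surj _ _ _ _ f _ Bb.
by exists n => //=; rewrite fn.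
Qed.

End covering.

(** Each piece F m `&` K n of P is compact and lies in a set with the triangle
    property, so mu can be swept there after scaling it to mass e. *)
Lemma polar_from_dense (R : realType) (X : ptopologicalType)
    (G : X -> X -> \bar R) (P P0 : set X) :
  locally_compact [set: X] -> hausdorff_space X -> @second_countable X ->
  borel_kernel G -> (forall x y, 0 < G x y) -> singular_on_diagonal G ->
  local_triangle_property G -> Fsigma P -> P `<=` closure P0 ->
  polar G setT P -> polar G P0 P.
Proof.
move=> lcX hX scX G_borel G_gt0 G_sing G_tri [F clF PF] PP0 polP.
have [|K [cK KU Kcov]] :=
    @countable_compact_cover _ [set U | open U /\ triangle_property G U]
      lcX hX scX.
  move=> x; have [U [oU Ux] triU] := G_tri x.
  by exists U => //; exact: open_nbhs_nbhs.
have -> : P = \bigcup_m \bigcup_n (F m `&` K n).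
  rewrite PF; under [RHS]eq_bigcupr do rewrite -setI_bigcupr.
  by under [RHS]eq_bigcupr do rewrite Kcov setIT.
apply: polar_bigcup => // m; apply: polar_bigcup => // n.
have FP : F m `<=` P by rewrite PF; exact: bigcup_sup.
apply: capacity_null_polar => // e e0.
have [mu [mu_e _ muoo]] := polar_small G_borel G_gt0 polP e0.
have [U [oU triU] KnU] := KU n.
have [|||x [Fx Kx]|nu [nu_mu nuP0 nu1]] :=
    @sweep_into _ _ G G_borel G_gt0 G_sing mu P0 U (F m `&` K n) oU triU.
- by rewrite setIC; exact: compact_closedI.
- by move=> x [_ /KnU].
- by move=> x [/FP/PP0].
- apply: infinite_potential_local => //.
  + exact: le_lt_trans mu_e (ltry _).
  + exact: KnU.
  + by apply: muoo; exact: FP.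
- by exists nu; split=> //; exact: le_trans nu_mu mu_e.
Qed.

Unset Implicit Arguments.

Theorem corollary1p2 (R : realType) (X : ptopologicalType)
    (X_lc : locally_compact [set: X])
    (X_hausdorff : hausdorff_space X)
    (X_countable_base : @second_countable X)
    (G : X -> X -> \bar R)
    (G_borel : borel_kernel G)
    (G_gt0 : forall x y, 0 < G x y)
    (G_sing : singular_on_diagonal G)
    (G_triangle : local_triangle_property G)
    (P : set X) (P_Fsigma : Fsigma P) (P_cstar : cstar G P = 0)
    (P0 : set X) (P0_sub : P0 `<=` P) (P0_countable : countable P0)
    (A : nat -> set X)
    (A_closed : forall m, closed (A m))
    (A_cover : \bigcup_m A m = P)
    (A_dense : forall m, A m `<=` closure (P0 `&` A m)) :
  exists2 mu : {finite_measure set (borelType X) -> \bar R},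
    radon_on P0 mu & forall x, P x -> potential G mu x = +oo.
Proof.
have P_closure : P `<=` closure P0.
  rewrite -A_cover => x [m _ Amx].
  by apply: closureS (A_dense m x Amx); exact: subIsetl.
have [nu [nu_fin nuP0 nuoo]] := polar_from_dense X_lc X_hausdorff
  X_countable_base G_borel G_gt0 G_sing G_triangle P_Fsigma P_closure
  (cstar0_polar G_borel G_gt0 P_cstar).
pose mu := mfrestr measurableT nu_fin.
have muE : mu = nu :> (set (borelType X) -> \bar R).
  by apply/funext => B; rewrite /mu/= /mfrestr /mrestr setIT.
exists mu.
  have muP0 : mu (~` P0) = 0 by rewrite muE.
  by split=> //; exact: countable_support_radon P0_countable muP0.
move=> x Px; rewrite -(nuoo x Px); apply: eq_measure_integral => B mB _.
by rewrite [LHS]/= /mfrestr /mrestr setIT.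
Qed.
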